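(* The maps $x[\cdot], x_+[\cdot]:\mathcal{LAB}\to\{0,1\}^{\mathbb Z}$ defined by $\mathcal M\mapsto x[\mathcal M]$ and $\mathcal M\mapsto x_+[\mathcal M]$ are homeomorphisms from $\mathcal{LAB}$ onto their images in $\{0,1\}^{\mathbb Z}$.
   Context: Write $\mathbb N=\{1,2,\dots\}$. An $\mathbb N$-vector is a function $\mathbf m:\mathbb N\to\{0,1,2,\dots\}$ with finite support $\mathrm{supp}\,\mathbf m$; $FIN(\mathbb N)$ is the additive monoid of all $\mathbb N$-vectors, with identity $\mathbf 0$ and the pointwise order. A label is a set $\mathcal M\subset FIN(\mathbb N)$ such that $\mathbf 0\le\mathbf m_1\le\mathbf m\in\mathcal M$ implies $\mathbf m_1\in\mathcal M$. $\mathcal{LAB}$ is the space of all labels (including $\emptyset$) with the ultrametric $d(\mathcal M_1,\mathcal M_2)=\inf\{2^{-N}:N\ge0,\ \mathcal M_1\cap\mathcal B_N=\mathcal M_2\cap\mathcal B_N\}$, where $\mathcal B_N$ is the set of $\mathbb N$-vectors $\mathbf m$ with $\mathbf m_\ell<N$ for all $\ell$ and $\mathrm{supp}\,\mathbf m\subset[1,N]$. Fix an odd integer $b\ge5$ and a partition $\{D_\ell:\ell\in\mathbb N\}$ of $\mathbb N$ into infinite sets with $\min D_\ell<\min D_{\ell+1}$. Define $k:\mathbb Z\to\mathbb Z$ by $k(n)=b^{n-1}$ for $n\ge1$, $k(0)=0$, $k(-n)=-k(n)$. $IP(k)$ (resp. $IP_+(k)$) is the set of sums of finite subsets of $k(\mathbb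 Z)$ (resp. of $k(\{0,1,2,\dots\})$). Each $t\in IP(k)$ has a unique expansion $t=k(j_1)+\dots+k(j_r)$ with $|j_1|>\dots>|j_r|>0$ ($r=0$ for $t=0$); its length vector $\mathbf r(t)\in FIN(\mathbb N)$ is $\mathbf r(t)_\ell=\#\{i:|j_i|\in D_\ell\}$. For a label $\mathcal M$, $A[\mathcal M]=\{t\in IP(k):\mathbf r(t)\in\mathcal M\}$, $A_+[\mathcal M]=A[\mathcal M]\cap IP_+(k)$, and $x[\mathcal M],x_+[\mathcal M]\in\{0,1\}^{\mathbb Z}$ are the characteristic functions of $A[\mathcal M]$ and $A_+[\mathcal M]$. $\{0,1\}^{\mathbb Z}$ carries the product topology. *)

(* Defs.v *)
From HB Require Import structures.
From mathcomp Require Import all_boot all_order all_algebra finmap.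
From mathcomp Require Import all_classical all_reals all_analysis.
Set Implicit Arguments.
Unset Strict Implicit.
Unset Printing Implicit Defensive.
Import Order.TTheory GRing.Theory Num.Theory.
Local Open Scope classical_set_scope.
Local Open Scope ring_scope.

Definition posnat := {n : nat | (0 < n)%N}.

Definition posnat1 : posnat := exist _ 1%N isT.

Definition posnat_succ (n : posnat) : posnat := exist _ (val n).+1 isT.

(* The default value is only taken when [A] is empty. *)
Definition posnat_min (A : set posnat) : posnat :=
  xget posnat1 [set m | A m /\ forall n, A n -> (val m <= val n)%N].

Definition FIN : set (posnat -> nat) :=
  [set m | finite_set [set l | m l != 0%N]].

Record label := Label {
  label_set :> set (posnat -> nat) ;
  label_FIN : label_set `<=` FIN ;
  label_down : forall m1 m : posnat -> nat, FIN m1 ->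
    (forall l, (m1 l <= m l)%N) -> label_set m -> label_set m1 }.

Definition box (N : nat) : set (posnat -> nat) :=
  [set m | FIN m /\ (forall l, (m l < N)%N) /\
           (forall l, m l != 0%N -> (val l <= N)%N)].

(* [R] is a phantom parameter: it fixes the real numbers in which the distance
   takes its values, so that the metric structure can be inferred. *)
Definition LAB (R : realType) : Type := label.

HB.instance Definition _ (R : realType) := gen_eqMixin (LAB R).
HB.instance Definition _ (R : realType) := gen_choiceMixin (LAB R).

Section metric.
Variable R : realType.
Implicit Types M : LAB R.

Definition agree M1 M2 : set nat :=
  [set N | label_set M1 `&` box N = label_set M2 `&` box N].

Definition label_dist M1 M2 : R := inf [set 2 ^- N | N in agree M1 M2].

Lemma box_mono N1 N2 : (N1 <= N2)%N -> box N1 `<=` box N2.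
Proof.
move=> N12 m [Fm [m1 m2]]; split=> //; split=> l; first exact: leq_trans (m1 l) _.
by move=> /m2 /leq_trans; apply.
Qed.

Lemma agree_mono M1 M2 N1 N2 :
  (N1 <= N2)%N -> agree M1 M2 N2 -> agree M1 M2 N1.
Proof.
move=> N12; rewrite /agree/= => e.
have bE : box N1 = box N2 `&` box N1 by rewrite (setIidr (box_mono N12)).
by rewrite bE (setIA (label_set M1)) (setIA (label_set M2)) e.
Qed.

Lemma agree0 M1 M2 : agree M1 M2 0%N.
Proof.
have b0 : box 0 = set0 by rewrite -subset0 => m [_ [/(_ posnat1)]].
by rewrite /agree/= b0 !setI0.
Qed.

Lemma label_dist_has_inf M1 M2 :
  has_inf [set (2 : R) ^- N | N in agree M1 M2].
Proof.
split; first by exists (2 ^- 0), 0%N => //; exact: agree0.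
by exists 0 => _ [N _ <-]; rewrite invr_ge0 exprn_ge0.
Qed.

Lemma label_dist_le M1 M2 N : agree M1 M2 N -> label_dist M1 M2 <= 2 ^- N.
Proof.
by move=> MN; apply: ge_inf; [case: (label_dist_has_inf M1 M2)|exists N].
Qed.

Lemma label_dist_approx M1 M2 (e : R) : 0 < e ->
  exists2 N, agree M1 M2 N & 2 ^- N < label_dist M1 M2 + e.
Proof.
move=> e0; have [_ [N MN <-] lt] := inf_adherent e0 (label_dist_has_inf M1 M2).
by exists N.
Qed.

Lemma label_dist_ge0 M1 M2 : 0 <= label_dist M1 M2.
Proof.
apply: lb_le_inf; first by case: (label_dist_has_inf M1 M2).
by move=> _ [N _ <-]; rewrite invr_ge0 exprn_ge0.
Qed.

Lemma exp2_small (e : R) : 0 < e -> exists N, (2 : R) ^- N < e.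
Proof.
move=> e0; exists (Num.truncn e^-1).+1.
rewrite -[ltRHS]invrK ltf_pV2 ?posrE ?invr_gt0 ?exprn_gt0//.
apply: lt_trans (truncnS_gt _) _.
by rewrite -natrX ltr_nat ltn_expl.
Qed.

Lemma label_dist_xx M : label_dist M M = 0.
Proof.
apply/eqP; rewrite eq_le label_dist_ge0 andbT; apply/ler_addgt0Pl => e e0.
have [N Ne] := exp2_small e0.
by rewrite addr0 (le_trans _ (ltW Ne))// label_dist_le.
Qed.

Lemma box_cover m : FIN m -> exists N, box N m.
Proof.
move=> Fm; have [S SE] : exists S : {fset posnat}, [set l | m l != 0%N] = [set` S].
  exact/finite_fsetP.
exists (\sum_(l <- S) (m l + val l)).+1; split=> //.
have le l : m l != 0%N -> (m l + val l <= \sum_(l <- S) (m l + val l))%N.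
  move=> ml; have lS : l \in S by have : [set l | m l != 0%N] l by []; rewrite SE.
  by rewrite (big_fsetD1 l)//= leq_addr.
split=> l; last by move=> /le /(leq_trans (leq_addl _ _)) /leqW.
have [->//|/le] := eqVneq (m l) 0%N.
by rewrite ltnS; apply: leq_trans; exact: leq_addr.
Qed.

Lemma label_eq M1 M2 : label_set M1 = label_set M2 -> M1 = M2.
Proof.
case: M1 M2 => [M F d] [M' F' d'] /= e; subst M'.
by rewrite (Prop_irrelevance F F') (Prop_irrelevance d d').
Qed.

Lemma label_dist_positivity M1 M2 : label_dist M1 M2 = 0 -> M1 = M2.
Proof.
move=> d0; have ag N : agree M1 M2 N.
  have e0 : (0 : R) < 2 ^- N by rewrite invr_gt0 exprn_gt0.
  have [N' a] := label_dist_approx M1 M2 e0.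
  rewrite d0 add0r => lt; apply: agree_mono a.
  move: lt; rewrite ltf_pV2 ?posrE ?exprn_gt0// ltr_eXn2l ?ltr1n//.
  exact: ltnW.
apply: label_eq; apply/seteqP; split=> m Mm.
- have [N Nm] := box_cover (label_FIN Mm).
  by have := ag N; rewrite /agree/= => /seteqP[/(_ m (conj Mm Nm))[]].
- have [N Nm] := box_cover (label_FIN Mm).
  by have := ag N; rewrite /agree/= => /seteqP[_ /(_ m (conj Mm Nm))[]].
Qed.

Lemma label_dist_sym M1 M2 : label_dist M1 M2 = label_dist M2 M1.
Proof.
by congr (inf _); apply/seteqP; split=> _ [N a <-]; exists N.
Qed.

Lemma label_dist_triangle M2 M1 M3 :
  label_dist M1 M3 <= label_dist M1 M2 + label_dist M2 M3.
Proof.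
apply/ler_addgt0Pl => e e0; have e2 : 0 < e / 2 by rewrite divr_gt0.
have [N1 a1 l1] := label_dist_approx M1 M2 e2.
have [N2 a2 l2] := label_dist_approx M2 M3 e2.
have a3 : agree M1 M3 (minn N1 N2).
  rewrite /agree/=; transitivity (label_set M2 `&` box (minn N1 N2)).
    exact: agree_mono (geq_minl _ _) a1.
  exact: agree_mono (geq_minr _ _) a2.
apply: le_trans (label_dist_le a3) _.
apply: (@le_trans _ _ (2 ^- N1 + 2 ^- N2)).
  by rewrite /minn; case: ifP => _; rewrite ?lerDl ?lerDr invr_ge0 exprn_ge0.
apply: le_trans (lerD (ltW l1) (ltW l2)) _.
by rewrite addrACA -splitr addrC.
Qed.

HB.instance Definition _ := @isMetric.Build R (LAB R) label_dist
  label_dist_xx label_dist_positivity label_dist_sym label_dist_triangle.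

End metric.

Section IP.
Variable b : nat.

Definition kseq (n : int) : int :=
  match n with
  | Posz 0 => 0
  | Posz n'.+1 => (b ^ n')%N%:Z
  | Negz n' => - (b ^ n')%N%:Z (* [Negz n'] is [- n'.+1] *)
  end.

Definition fin_sums (K : set int) : set int :=
  [set t | exists2 F : {fset int}, [set` F] `<=` K & t = \sum_(a <- F) a].

Definition IP : set int := fin_sums (range kseq).

Definition IP_pos : set int := fin_sums (kseq @` [set n | 0 <= n]).

Definition is_expansion (t : int) (s : seq int) : Prop :=
  [/\ sorted (fun i j => `|j| < `|i|) s, all (fun j => 0 < `|j|) s
    & t = \sum_(j <- s) kseq j].

(* Definite description: for odd [b >= 5] and [t] in [IP] the expansion exists
   and is unique. *)
Definition expansion (t : int) : seq int := xget [::] (is_expansion t).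

Variable D : posnat -> set posnat.

Definition length_vector (t : int) (l : posnat) : nat :=
  count (fun j : int => `|j|%N \in val @` D l) (expansion t).

Definition Aset (M : set (posnat -> nat)) : set int :=
  [set t | IP t /\ M (length_vector t)].

Definition Aset_pos (M : set (posnat -> nat)) : set int := Aset M `&` IP_pos.

Definition xchar (R : realType) (M : LAB R) : {ptws int -> bool} :=
  fun t => t \in Aset M.

Definition xchar_pos (R : realType) (M : LAB R) : {ptws int -> bool} :=
  fun t => t \in Aset_pos M.

End IP.

Definition homeomorphism_onto_image (X Y : topologicalType) (f : X -> Y) : Prop :=
  continuous f /\
  exists2 g : Y -> X, cancel f g & {within range f, continuous g}.

(* Main.v *)
Require Import Defs.
From mathcomp Require Import all_boot all_order all_algebra finmap zify.
From mathcomp Require Import all_classical all_reals all_analysis.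

(** Both maps send a label M to the set of those t in P, with P = IP(k) or
    P = IP_+(k), whose length vector r(t) lies in M.  Everything follows from two
    facts about r: each r(t) has finite support ([length_vector_FIN]), and each
    finitely supported vector is r(t) for some t in IP_+(k)
    ([length_vector_onto]).

    By the first fact, the coordinate at t of the image of M only asks whether one
    vector of some box B_N belongs to M, so it does not change when M moves by
    less than 2^-N: the map is continuous.

    By the second fact, choose for each vector m a time t with r(t) = m.  The
    coordinate at this t of the image of M says whether m lies in M, so the map
    is injective.  Since B_N is finite, agreeing at finitely many times with the
    image of M forces a label to agree with M on B_N, that is, to be within 2^-N
    of M: the inverse is continuous on the range.  These arguments are carried
    out in [homeomorphism_of_membership] for an arbitrary function r with the two
    properties, hence apply to both maps at once.

    The second fact is where the arithmetic enters.  As every D_l is infinite, one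
    can pick positions one at a time, each beyond all previous ones and in a
    prescribed D_l, so any finitely many prescribed numbers of positions in the D_l
    are attained by a decreasing sequence of positive integers.  The sum of the corresponding
    k(j) has this sequence as its expansion because expansions are unique
    ([expansion_uniq]): for b >= 3 the terms below the leading one add up to less
    than half of it ([tail_lt_lead]), so the sum determines its leading term. *)

Set Implicit Arguments.
Unset Strict Implicit.
Unset Printing Implicit Defensive.
Import Order.TTheory GRing.Theory Num.Theory.
Local Open Scope classical_set_scope.

(** * Uniqueness of expansions *)

Section Expansion.
Local Open Scope ring_scope.
Variable b : nat.
Hypothesis b_ge3 : (3 <= b)%N.

Local Notation decr := (fun i j : int => `|j| < `|i|).

Lemma kseq_abs (j : int) : j != 0 -> `|kseq b j| = (b ^ (`|j|%N.-1))%N%:Z.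
Proof. by case: j => [[|n]|n] //= _; rewrite ?normrN. Qed.

Lemma kseqN (j : int) : kseq b (- j) = - kseq b j.
Proof. by case: j => [[|n]|n] //=; rewrite ?oppr0 ?opprK. Qed.

Lemma kseq_gap (i j : int) :
  i != 0 -> `|i| < `|j| -> 3 * `|kseq b i| <= `|kseq b j|.
Proof.
move=> i0 ij; have j0 : j != 0 by lia.
rewrite !kseq_abs//.
have : (b * b ^ `|i|.-1 <= b ^ `|j|.-1)%N by rewrite -expnS leq_pexp2l; lia.
by nia.
Qed.

(** The geometric estimate: if the tail starts with j, then its remaining terms
    contribute less than half of |k(j)|, so the whole tail is less than
    (3/2) |k(j)|, which is at most |k(i)| / 2 as b >= 3. *)
Lemma tail_lt_lead (i : int) (s : seq int) :
  i != 0 -> path decr i s -> all (fun j => 0 < `|j|) s ->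
  `|2 * \sum_(j <- s) kseq b j| < `|kseq b i|.
Proof.
elim: s i => [|j s IH] i i0 /=.
  by rewrite big_nil mulr0 normr0 kseq_abs// ltz_nat expn_gt0; lia.
move=> /andP[ji js] /andP[j0 sall].
have {j0} j0 : j != 0 by lia.
have := IH j j0 js sall; have := kseq_gap j0 ji.
rewrite big_cons; move: (kseq b i) (kseq b j) (\sum_(_ <- _) _) => x y z; lia.
Qed.

(** By [tail_lt_lead], twice a sum lies strictly between one and three times
    its leading term in absolute value, on the side of the sign of that term.  Two
    expansions of one number therefore have the same leading index, which can be
    cancelled. *)
Lemma expansion_uniq (s s' : seq int) (t : int) :
  is_expansion b t s -> is_expansion b t s' -> s = s'.
Proof.
elim: s s' t => [|i s IH] [|j s'] t //.
- case=> _ _ -> [/= jp /andP[j0 ja]].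
  have {}j0 : j != 0 by lia.
  have := tail_lt_lead j0 jp ja; rewrite big_nil big_cons.
  by move: (kseq b j) (\sum_(_ <- _) _) => x y; lia.
- case=> /= ip /andP[i0 ia] -> [_ _].
  have {}i0 : i != 0 by lia.
  have := tail_lt_lead i0 ip ia; rewrite big_nil big_cons.
  by move: (kseq b i) (\sum_(_ <- _) _) => x y; lia.
case=> /= ip /andP[i0 ia] -> [/= jp /andP[j0 ja]].
have {}i0 : i != 0 by lia.
have {}j0 : j != 0 by lia.
have := tail_lt_lead i0 ip ia; have := tail_lt_lead j0 jp ja; rewrite !big_cons.
set S := \sum_(_ <- s) _; set S' := \sum_(_ <- s') _ => jb ib e.
(* If |i| < |j|, then |k(j)| is at least 3 |k(i)|, so the second sum is too big;
   if i = - j, then the two sums have opposite signs. *)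
have ij : i = j.
  have [lt|lt|eqa] := ltgtP `|i| `|j|.
  - have := kseq_gap i0 lt.
    by move: (kseq b i) (kseq b j) S S' jb ib e => x y z w; lia.
  - have := kseq_gap j0 lt.
    by move: (kseq b i) (kseq b j) S S' jb ib e => x y z w; lia.
  have [->//|eN] : i = j \/ i = - j by lia.
  have := kseqN j; rewrite -eN.
  by move: (kseq b i) (kseq b j) S S' jb ib e => x y z w; lia.
rewrite -ij in jp e *; congr cons; apply: (IH s' S).
  by split=> //; exact: path_sorted ip.
split=> //; first exact: path_sorted jp.
by move: e => /addrI.
Qed.

Lemma expansionE (t : int) (s : seq int) :
  is_expansion b t s -> expansion b t = s.
Proof.
by move=> ts; apply: (expansion_uniq _ ts); apply: xgetI ts.
Qed.

Lemma kseq_pos_inj : injective (fun n : nat => kseq b n).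
Proof.
have b1 : (1 < b)%N by lia.
move=> [|m] [|n] //= [].
- by move/eqP; rewrite eq_sym expn_eq0; lia.
- by move/eqP; rewrite expn_eq0; lia.
by move/eqP; rewrite eqn_exp2l// => /eqP->.
Qed.

Lemma IP_pos_sum (s : seq nat) : uniq s ->
  IP_pos b (\sum_(j <- map Posz s) kseq b j).
Proof.
move=> us; pose u := [seq kseq b (Posz n) | n <- s].
have uu : uniq u by rewrite map_inj_uniq//; exact: kseq_pos_inj.
(* An element of IP_+(k) is the sum of a set of values of k, so the k(n) must be
   distinct for the sum over the set to be the sum over s. *)
exists [fset x in u]%fset.
  by move=> x /=; rewrite inE => /mapP[n _ ->]; exists (Posz n).
rewrite [RHS](perm_big u); last first.
  by apply: uniq_perm; rewrite ?fset_uniq// => x; rewrite inE.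
by rewrite !big_map.
Qed.

Lemma IP_pos_sub_IP : IP_pos b `<=` IP b.
Proof.
move=> _ [F FK ->]; by exists F => // x /FK[n _ <-]; exists n.
Qed.

End Expansion.

(** * Length vectors *)

Section LengthVector.
Local Open Scope ring_scope.
Variable b : nat.
Variable D : posnat -> set posnat.
Hypothesis D_triv : trivIset [set: posnat] D.

Lemma part_uniq (n : nat) (l l' : posnat) :
  n \in val @` D l -> n \in val @` D l' -> l = l'.
Proof.
rewrite !inE => -[x Dx <-] [y Dy /val_inj xy]; subst y.
by apply: D_triv => //; exists x.
Qed.

(** The expansion is a finite list and each of its entries is counted by at most
    one coordinate, as the D_l are disjoint. *)
Lemma length_vector_FIN (t : int) : FIN (length_vector b D t).
Proof.
pose cl (j : int) := xget posnat1 [set l | `|j|%N \in val @` D l].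
apply: sub_finite_set (finite_image cl (finite_seq (expansion b t))) => l /=.
rewrite -lt0n -has_count => /hasP[j js jl]; exists j => //.
apply: (part_uniq _ jl).
exact: (@xgetI _ posnat1 [set l | `|j|%N \in val @` D l] l jl).
Qed.

Hypothesis D_infinite : forall l, infinite_set (D l).

Lemma part_unbounded (l : posnat) (N : nat) :
  exists2 n, (N < n)%N & n \in val @` D l.
Proof.
apply: contrapT => no; apply: (@D_infinite l).
apply: (@sub_finite_set _ _ (val @^-1` `I_N.+1)).
  move=> n Dn /=; rewrite ltnNge; apply/negP => lt; apply: no; exists (val n) => //.
  by rewrite inE; exists n.
apply: finite_preimage; last exact: finite_II.
by move=> x y _ _; exact: val_inj.
Qed.

(** The prescribed vector is given as a list L of coordinates with multiplicity,
    so that it can be realized by induction: each new position is taken larger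
    than the head of the decreasing sequence built so far. *)
Lemma decreasing_positions (L : seq posnat) : exists s : seq nat,
  [/\ sorted gtn s, all (ltn 0) s
    & forall l, count (fun n => n \in val @` D l) s = count_mem l L].
Proof.
elim: L => [|l0 L [s [so sp sc]]]; first by exists [::].
have [n nlt nl0] := part_unbounded l0 (head 0%N s).
exists (n :: s); split.
- by case: s so nlt {sp sc} => //= m s -> ->.
- by rewrite /= sp (leq_ltn_trans _ nlt).
move=> l /=; rewrite sc; congr (nat_of_bool _ + _)%N.
apply/idP/eqP => [nl|<-//]; exact: part_uniq nl0 nl.
Qed.

(** Turns a finitely supported vector into the list of coordinates expected by
    [decreasing_positions]. *)
Lemma FIN_count (m : posnat -> nat) : FIN m ->
  exists L : seq posnat, forall l, count_mem l L = m l.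
Proof.
move=> /finite_fsetP[S SE].
exists (flatten [seq nseq (m l) l | l <- S]) => l.
rewrite count_flatten -map_comp sumnE big_map.
under eq_bigr do rewrite /= count_nseq /=.
have [lS|lS] := boolP (l \in S).
  rewrite (big_fsetD1 l)//= eqxx mul1n big_seq big1 ?addn0// => x.
  by rewrite !inE => /andP[/negPf-> _].
rewrite big_seq big1; last first.
  by move=> x xS; case: eqVneq xS lS => // -> ->.
apply/esym/eqP; apply: contraNT lS => ml.
by have : [set l | m l != 0%N] l by []; rewrite SE.
Qed.

Hypothesis b_ge3 : (3 <= b)%N.

Lemma length_vector_onto (m : posnat -> nat) : FIN m ->
  exists2 t, IP_pos b t & length_vector b D t = m.
Proof.
move=> /FIN_count[L Lm]; have [s [so sp sc]] := decreasing_positions L.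
have us : uniq s.
  by apply: sorted_uniq so => [x y z|x]; rewrite /= ?ltnn//; lia.
exists (\sum_(j <- map Posz s) kseq b j); first exact: IP_pos_sum.
apply/funext => l; rewrite /length_vector (@expansionE b b_ge3 _ (map Posz s)).
  by rewrite count_map -Lm -sc.
split=> //; first by rewrite sorted_map.
by rewrite all_map.
Qed.

End LengthVector.

(** * Topology *)

Lemma ptws_bool_cvgP (I : choiceType) (F : set_system {ptws I -> bool})
    (f : {ptws I -> bool}) : Filter F ->
  F --> f <-> forall t, \forall g \near F, g t = f t.
Proof.
(* The index type carries no topology of its own; the topology of pointwise
   convergence does not depend on the one it is given. *)
move=> FF; apply: iff_trans (@pointwise_cvgP (discrete_topology I) _ F f FF) _.
split=> cvg t; first exact: (cvg t [set f t] (discrete_set1 _)).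
by move=> A /nbhs_singleton At; apply: filterS (cvg t) => g /= ->.
Qed.

Section Topology.
Local Open Scope ring_scope.
Variable R : realType.

(** A vector of B_N is determined by its restriction to [1, N], whose values are
    below N. *)
Lemma finite_box (N : nat) : finite_set (box N).
Proof.
pose F (h : {ffun 'I_N.+1 -> 'I_N.+1}) (l : posnat) : nat :=
  if (val l <= N)%N then nat_of_ord (h (inord (val l))) else 0%N.
apply: sub_finite_set (finite_image F (@finite_finset _ setT)) => m [_ [mN ms]].
(* Coordinates are positive integers, so the value of h at 0 is a dummy. *)
have sN (n : nat) : exists l : posnat, (0 < n)%N -> val l = n.
  by case: n => [|n]; [exists posnat1|exists (exist _ n.+1 isT)].
exists [ffun i : 'I_N.+1 => inord (m (sval (cid (sN i))))] => //.
apply/funext => l; rewrite /F; case: leqP => [lN|Nl]; last first.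
  by apply/esym/eqP; apply: contraTT Nl => /ms; rewrite leqNgt.
rewrite ffunE; case: (cid _) => l' /=; rewrite inordK// => /(_ (valP l)) /val_inj->.
by rewrite inordK// ltnS ltnW.
Qed.

(** The distance is the infimum of the 2^-N' over the N' at which the labels
    agree, so if it is below 2^-N, then they agree at some N' > N. *)
Lemma agree_ball (M1 M2 : LAB R) (N : nat) :
  ball M1 (2 ^- N) M2 -> agree M1 M2 N.
Proof.
rewrite ballEmdist /= => d.
have [|N' a lt] := @label_dist_approx R M1 M2 (2 ^- N - label_dist M1 M2).
  by rewrite subr_gt0.
rewrite addrC subrK in lt; apply: agree_mono a.
move: lt; rewrite ltf_pV2 ?posrE ?exprn_gt0// ltr_eXn2l ?ltr1n//.
exact: ltnW.
Qed.

Lemma agreeP (M1 M2 : LAB R) (N : nat) : agree M1 M2 N <->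
  (forall m, box N m -> label_set M1 m <-> label_set M2 m).
Proof.
split=> [/seteqP[s1 s2] m bm|h].
  by split=> Mm; [case: (s1 m)|case: (s2 m)].
by apply/seteqP; split=> m [Mm bm]; split=> //; apply/(h m bm).
Qed.

(* The abstract situation: f codes a label M by the set of the t in P with
   v t in M.  Both maps of the theorem are of this form. *)
Variables (P : set int) (v : int -> posnat -> nat).
Hypothesis v_FIN : forall t, FIN (v t).
Hypothesis v_onto : forall m, FIN m -> exists2 t, P t & v t = m.
Variable f : LAB R -> {ptws int -> bool}.
Hypothesis fE : forall M t, f M t <-> P t /\ label_set M (v t).

Lemma membership_continuous : continuous f.
Proof.
move=> M; have fM := fmap_filter f (nbhs_filter M).
apply/ptws_bool_cvgP => t; have [N vN] := box_cover (v_FIN t).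
apply/nbhs_ballP; exists (2 ^- N); first by rewrite /= invr_gt0 exprn_gt0.
move=> M' /agree_ball/agreeP/(_ _ vN) h /=.
by apply/idP/idP => /fE[Pt /h vM]; apply/fE.
Qed.

(** One coordinate of the image at a time t representing m decides whether m
    lies in the label. *)
Lemma membership_transfer (M M' : LAB R) (m : posnat -> nat) (t : int) :
  P t -> v t = m -> f M t = f M' t -> label_set M m <-> label_set M' m.
Proof.
move=> Pt <- e; have := fE M t; have := fE M' t; rewrite e => h h'.
by split=> Mm; [case: (h.1 (h'.2 (conj Pt Mm)))|case: (h'.1 (h.2 (conj Pt Mm)))].
Qed.

Lemma membership_inj : injective f.
Proof.
move=> M M' e; apply: label_eq; apply/seteqP; split=> m Mm.
all: have [t Pt vt] := v_onto (label_FIN Mm).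
all: by have [h h'] := membership_transfer Pt vt (congr1 (@^~ t) e); auto.
Qed.

(** Continuity of the inverse in a form that does not mention the inverse: the
    finite set of times representing the vectors of B_N yields the
    neighbourhood. *)
Lemma near_agree (M : LAB R) (N : nat) :
  \forall y \near f M, forall M' : LAB R, f M' = y -> agree M M' N.
Proof.
have /finite_fsetP[S SE] := finite_box N.
have SF m : m \in S -> exists2 t, P t & v t = m.
  by move=> mS; apply: v_onto; have : [set` S] m by []; rewrite -SE => -[].
pose A (m : posnat -> nat) : set {ptws int -> bool} :=
  [set y | exists2 t, P t /\ v t = m & y t = f M t].
have : nbhs (f M) (\bigcap_(m in [set` S]) A m).
  apply: filter_bigI => m /SF[t Pt vt].
  have [+ _] := @ptws_bool_cvgP int (nbhs (f M)) (f M) _.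
  by move=> /(_ cvg_id t); apply: filterS => y yt; exists t.
apply: filterS => y Ay M' ey; apply/agreeP => m bm.
have [|t [Pt vt] e] := Ay m; first by rewrite -SE.
by apply: (membership_transfer Pt vt); rewrite ey e.
Qed.

Lemma homeomorphism_of_membership : homeomorphism_onto_image f.
Proof.
split; first exact: membership_continuous.
(* Off the range of f the inverse is sent to the empty label. *)
pose g (y : {ptws int -> bool}) : LAB R :=
  xget (Label (@sub0set _ _) (fun _ _ _ _ x => x) : LAB R) [set M | f M = y].
have fK : cancel f g.
  by move=> M; apply: membership_inj; exact: (@xgetI _ _ [set M' | f M' = f M] M).
exists g => //; apply/subspace_continuousP => _ [M _ <-].
rewrite /from_subspace fK.
apply/cvg_ballP => e e0; have [N Ne] := exp2_small e0.
apply: filterS (near_agree M N) => y Ay [M' _ ey]; rewrite -ey /= fK.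
by rewrite ballEmdist /=; apply: le_lt_trans Ne; apply: label_dist_le; exact: Ay.
Qed.

End Topology.

Theorem theorem3p18 (R : realType) (b : nat) (D : posnat -> set posnat)
    (b_odd : odd b) (b_ge5 : (5 <= b)%N)
    (D_partition : partition [set: posnat] D [set: posnat])
    (D_infinite : forall l, infinite_set (D l))
    (D_min : forall l,
      (val (posnat_min (D l)) < val (posnat_min (D (posnat_succ l))))%N) :
  homeomorphism_onto_image (@xchar b D R) /\
  homeomorphism_onto_image (@xchar_pos b D R).
Proof.
have b_ge3 : (3 <= b)%N by apply: leq_trans b_ge5.
have [_ D_triv _] := D_partition.
have onto := @length_vector_onto b D D_triv D_infinite b_ge3.
split.
- apply: (@homeomorphism_of_membership R (IP b) (length_vector b D)).
  + exact: length_vector_FIN.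
  + by move=> m /onto[t /IP_pos_sub_IP]; exists t.
  + by move=> M t; rewrite /xchar inE.
- apply: (@homeomorphism_of_membership R (IP_pos b) (length_vector b D)).
  + exact: length_vector_FIN.
  + exact: onto.
  + move=> M t; rewrite /xchar_pos inE; split=> [[[_ ?] ?]//|[Pt ?]].
    by split=> //; split=> //; exact: IP_pos_sub_IP.
Qed.
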